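(* Let $H=\{(x,y)\in\{1,\dots,n\}^2 : |x-\tfrac{n+1}{2}|+|y-\tfrac{n+1}{2}|\le \tfrac{n-1}{2}\}$ be the (maximal) square with sides parallel to the lines $y=\pm x$ inscribed in $G_n=\{1,\dots,n\}^2$. Then $F(H)=\Theta(n^{3/2})$; more precisely, $F(H)\ge (1+o(1))\,\tfrac23\sqrt{\tfrac{2}{\pi}}\,n^{3/2}$ and $F(H)\le c\,n^{3/2}$ with $c=(2\ln 2)^{1/2}$.
   Context: Switching game on a board $H\subseteq\{1,\dots,n\}^2$: there is one switch for each row and each column meeting $H$. An initial configuration is $a_{ij}\in\{-1,+1\}$ for $(i,j)\in H$; a switch setting is $x_i,y_j\in\{-1,+1\}$. The signed discrepancy is $\sum_{(i,j)\in H}a_{ij}x_iy_j$ and the maximum discrepancy is $F(H)=\min_{(a_{ij})}\max_{(x_i),(y_j)}\sum_{(i,j)\in H}a_{ij}x_iy_j$. The paper describes $H$ only as ''a maximal square whose sides are parallel to $y=\pm x$ inscribed in $G_n$''; the explicit formula above is one such board (boundary details are asymptotically irrelevant). *)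

(* Defs.v *)
From HB Require Import structures.
From mathcomp Require Import all_boot all_order all_algebra.
From mathcomp Require Import all_classical all_reals all_analysis.
Set Implicit Arguments.
Unset Strict Implicit.
Unset Printing Implicit Defensive.
Import Order.TTheory GRing.Theory Num.Theory.
Local Open Scope ring_scope.

(* An element of 'I_n is 0-based: i : 'I_n stands for the integer i.+1 of
   {1, ..., n}. *)
Notation grid n := ('I_n * 'I_n)%type.

Definition sgn (b : bool) : int := (-1) ^+ b.

Definition config (n : nat) := {ffun grid n -> bool}.

Definition setting (n : nat) := ({ffun 'I_n -> bool} * {ffun 'I_n -> bool})%type.

(* Only cells of H are summed, so the signs of [a] outside H and the switches
   of the lines that do not meet H are dummies: they do not change the extrema
   below. *)
Definition signed_disc (n : nat) (H : {set grid n}) (a : config n)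
    (s : setting n) : int :=
  \sum_(p in H) sgn (a p) * sgn (s.1 p.1) * sgn (s.2 p.2).

(* In the two extrema the initial value of the iteration is itself one of the
   values iterated over (the index types are nonempty), so these are the
   genuine maximum and minimum. *)
Definition best_disc (n : nat) (H : {set grid n}) (a : config n) : int :=
  \big[Num.max/signed_disc H a ([ffun=> false], [ffun=> false])]_(s : setting n)
     signed_disc H a s.

Definition max_disc (n : nat) (H : {set grid n}) : int :=
  \big[Num.min/best_disc H [ffun=> false]]_(a : config n) best_disc H a.

Definition diamond (n : nat) : {set grid n} :=
  [set p : grid n |
    `| (p.1.+1)%:R - (n.+1)%:R / 2 | + `| (p.2.+1)%:R - (n.+1)%:R / 2 |
      <= (n%:R - 1) / 2 :> rat].

(* Main.v *)
(* Lower bound: fix the initial configuration, choose the column switches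
   uniformly at random and then the best row switches.  A row with k cells
   contributes E|S_k|, where S_k is the k-th position of the simple random walk,
   and Wallis' inequality gives E|S_(2d+1)| >= sqrt (2(2d+1)/pi).  The rows of
   the diamond have each of the lengths 1, 3, ..., 2M-1 (or longer) at least
   twice, where M = (n-1)/2 rounded down, and the sum of sqrt (2d+1) over d < M
   is at least (2M)^(3/2) / 3.
   Upper bound: for a uniformly random initial configuration each setting s has
   E exp (lam * disc s) = cosh (lam) ^ #|H| <= exp (lam ^ 2 * #|H| / 2).
   Reversing all the switches preserves the discrepancy, so only 2^(2n-1)
   settings count; optimizing lam gives F(H)^2 <= 2 #|H| (2n-1) ln 2.  Finally
   2 #|H| <= n^2 + 1 and (n^2 + 1)(2n - 1) = 2 n^3 - (n - 1)^2. *)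
Require Import Defs.
From HB Require Import structures.
From mathcomp Require Import all_boot all_order all_algebra.
From mathcomp Require Import all_classical all_reals all_analysis.
From mathcomp Require Import ring lra zify.
Set Implicit Arguments.
Unset Strict Implicit.
Unset Printing Implicit Defensive.
Import Order.TTheory GRing.Theory Num.Theory.
Import numFieldNormedType.Exports.
Local Open Scope classical_set_scope.
Local Open Scope ring_scope.

(** * Wallis' inequality *)

Lemma ge0_is_derive_le (R : realType) (f df : R -> R) (a b : R) :
  (forall x : R, is_derive x 1 f (df x)) -> a <= b ->
  (forall x : R, a < x < b -> 0 <= df x) -> f a <= f b.
Proof.
move=> fdf ab df_ge0; apply: (@ger0_derive1_le_cc R f a b) => //.
- move=> x; rewrite in_itv /= => /df_ge0; rewrite derive1E.
  by rewrite (@derive_val _ _ _ _ _ _ _ (fdf x)).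
- apply: continuous_subspaceT => x; apply: differentiable_continuous.
  by apply/derivable1_diffP.
- by rewrite in_itv /= lexx.
- by rewrite in_itv /= lexx andbT.
Qed.

(* The primitive of sin ^ n vanishing at 0, by the usual reduction formula. *)
Fixpoint sin_prim (R : realType) (n : nat) {struct n} : R -> R :=
  match n with
  | 0 => id
  | 1 => fun x => 1 - cos x
  | m.+2 => fun x =>
      (m.+2)%:R^-1 * ((m.+1)%:R * sin_prim m x - sin x ^+ m.+1 * cos x)
  end.

(** The recursion descends by two, hence strong induction; [cos ^ 2 = 1 - sin ^ 2] makes the product
    rule telescope. *)
Lemma is_derive_sin_prim (R : realType) (n : nat) (x : R) :
  is_derive x 1 (@sin_prim R n) (sin x ^+ n).
Proof.
elim/ltn_ind: n x => -[|[|m]] IHm x /=.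
- by rewrite expr0; apply: is_derive_id.
- apply: is_derive_eq.
  by rewrite add0r mul1r opprK expr1.
- have IH := IHm m (ltnW (ltnSn _)) x.
  have H : is_derive x 1 (fun y : R => sin y ^+ m.+1)
      (m.+1%:R * sin x ^+ m * cos x).
    have := @is_deriveX R R sin m.+1 x 1 _ (is_derive_sin x).
    by rewrite exprfctE.
  apply: is_derive_eq.
  rewrite /GRing.scale /=.
  have c2 : cos x * cos x = 1 - sin x * sin x.
    by rewrite -!expr2 -(cos2Dsin2 x) addrK.
  rewrite (_ : cos x * _ = m.+1%:R * sin x ^+ m * (cos x * cos x)); last by ring.
  rewrite c2 !exprS; field.
  by rewrite -natrD pnatr_eq0.
Qed.

Lemma sin_prim0 (R : realType) (n : nat) : sin_prim n (0 : R) = 0.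
Proof.
elim/ltn_ind: n => -[|[|m]] IH //=; first by rewrite cos0 subrr.
by rewrite IH// sin0 expr0n /= !mul0r mulr0 subr0 mulr0.
Qed.

(** Both primitives vanish at 0, and [sin ^ n.+1 <= sin ^ n] on [[0, pi / 2]] makes their difference
    nondecreasing. *)
Lemma sin_prim_le (R : realType) (n : nat) :
  sin_prim n.+1 (pi / 2 : R) <= sin_prim n (pi / 2).
Proof.
have pi0 : (0 : R) <= pi / 2 by rewrite divr_ge0 // pi_ge0.
pose f (x : R) := sin_prim n x - sin_prim n.+1 x.
suff : f 0 <= f (pi / 2) by rewrite /f !sin_prim0 subrr subr_ge0.
apply: (@ge0_is_derive_le _ _ (fun x => sin x ^+ n - sin x ^+ n.+1)) => //.
  by move=> x; apply: is_deriveB; exact: is_derive_sin_prim.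
move=> x /andP[x0 x1].
have s0 : 0 <= sin x by rewrite ltW// sin_gt0_pihalf// x0.
by rewrite subr_ge0 exprS ler_piMl ?exprn_ge0// sin_le1.
Qed.

(** For [x >= 0], the product of [exp (- x ^ 2 / 2)] and [2 cosh x] is nonincreasing: its derivative
    has the sign of [sinh x - x cosh x], and [D_ge0] shows that this is at most 0. *)
Lemma expR_sqr_ge_cosh (R : realType) (x : R) :
  (expR x + expR (- x)) / 2 <= expR (x ^+ 2 / 2).
Proof.
wlog x0 : x / 0 <= x => [hwlog|].
  have [/hwlog//|/ltW] := leP 0 x; rewrite -oppr_ge0 => /hwlog.
  by rewrite opprK sqrrN addrC.
have dN (y : R) : is_derive y 1 (fun z : R => expR (- z)) (- expR (- y)).
  by apply: is_derive_eq; rewrite mulrN1.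
have D_ge0 (y : R) :
    0 <= y -> 0 <= y * (expR y + expR (- y)) - (expR y - expR (- y)).
  move=> y0.
  pose f (z : R) := z * (expR z + expR (- z)) - (expR z - expR (- z)).
  suff : f 0 <= f y by rewrite /f mul0r oppr0 subrr subr0.
  apply: (@ge0_is_derive_le _ _ (fun z => z * (expR z - expR (- z)))) => //.
    move=> z; apply: is_derive_eq; rewrite /GRing.scale /=; ring.
  move=> z /andP[z0 _]; rewrite mulr_ge0 ?ltW// subr_gt0 ltr_expR; lra.
pose f (z : R) := - (expR (- (2^-1 * (z * z))) * (expR z + expR (- z))).
suff : f 0 <= f x.
  rewrite /f !mulr0 oppr0 expR0 mul1r lerN2 ler_pdivrMr // => h.
  by rewrite (mulrC (x ^+ 2)) expr2 -ler_pdivrMl ?expR_gt0// -expRN.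
apply: (@ge0_is_derive_le _ _ (fun z => expR (- (2^-1 * (z * z)))
    * (z * (expR z + expR (- z)) - (expR z - expR (- z))))) => //.
  move=> z; rewrite /f.
  have dq : is_derive z 1 (fun z : R => - (2^-1 * (z * z))) (- z).
    by apply: is_derive_eq; rewrite /GRing.scale /=; field.
  have de : is_derive z 1 (fun z : R => expR (- (2^-1 * (z * z))))
      (expR (- (2^-1 * (z * z))) * - z).
    exact: is_derive1_comp.
  apply: is_derive_eq; rewrite /GRing.scale /=; ring.
by move=> z /andP[z0 _]; rewrite mulr_ge0 ?expR_ge0// D_ge0// ltW.
Qed.

(* The probability that the simple random walk is at 0 at time 2j. *)
Definition central_prob (R : realType) (j : nat) : R :=
  'C(j.*2, j)%:R / 2 ^+ j.*2.

Lemma central_prob_gt0 (R : realType) (j : nat) : 0 < central_prob R j.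
Proof.
by rewrite divr_gt0 ?exprn_gt0 ?ltr0n// bin_gt0 -addnn leq_addr.
Qed.

(** The same recursion as that of the Wallis integrals, which lets both parities be expressed
    through [central_prob]. *)
Lemma central_probS (R : realType) (j : nat) :
  (j.*2.+2)%:R * central_prob R j.+1 = (j.*2.+1)%:R * central_prob R j.
Proof.
have binS : (j.+1 * 'C(j.*2.+2, j.+1) = 2 * (j.*2.+1 * 'C(j.*2, j)))%N.
  rewrite -[LHS]mul_bin_diag (mul_bin_down j.*2.+1 j).
  have -> : (j.*2.+1 - j = j.+1)%N by lia.
  by rewrite mulnA; congr (_ * _)%N; lia.
have /(congr1 (fun n : nat => n%:R : R)) := binS.
rewrite /central_prob doubleS !exprS !natrM => E.
have x0 : (2 : R) ^+ j.*2 != 0 by rewrite expf_neq0.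
set x := 2 ^+ _ in x0 *; set c' := 'C(_, _)%:R in E *.
set c := 'C(_, _)%:R in E *.
have -> : j.*2.+2%:R = 2 * j.+1%:R :> R by rewrite -natrM mul2n.
transitivity (j.+1%:R * c' / (2 * x)); first by field.
by rewrite E; field.
Qed.

Lemma sin_prim_pihalf (R : realType) (m : nat) :
  sin_prim m.+2 (pi / 2 : R) = (m.+1)%:R / (m.+2)%:R * sin_prim m (pi / 2).
Proof. by rewrite /= cos_pihalf mulr0 subr0 mulrA (mulrC _^-1). Qed.

Lemma sin_prim_even (R : realType) (j : nat) :
  sin_prim j.*2 (pi / 2) = pi / 2 * central_prob R j.
Proof.
elim: j => [|j IH]; first by rewrite /central_prob /= bin0 expr0 divr1 mulr1.
have n0 : j.*2.+2%:R != 0 :> R by rewrite pnatr_eq0.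
rewrite doubleS sin_prim_pihalf IH.
rewrite -(mulKf n0 (central_prob R j.+1)) central_probS.
by rewrite [LHS]mulrCA; congr (_ * _); rewrite -mulrA mulrCA.
Qed.

Lemma sin_prim_odd (R : realType) (j : nat) :
  sin_prim j.*2.+1 (pi / 2) = ((j.*2.+1)%:R * central_prob R j)^-1.
Proof.
elim: j => [|j IH].
  by rewrite /central_prob /= cos_pihalf bin0 expr0 divr1 mulr1 subr0 invr1.
have n0 : j.*2.+1%:R != 0 :> R by rewrite pnatr_eq0.
rewrite doubleS sin_prim_pihalf IH -central_probS.
move: (central_prob R j.+1) => c; rewrite !invfM mulrACA divff ?mul1r//.
Qed.

(** With [n = 2j+1] and [c = central_prob R j], comparing the Wallis integrals of orders [2j+1] and
    [2j] gives [1 <= (pi / 2) c (n c)], that is, [(n c) ^ 2 >= 2 n / pi]. *)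
Lemma central_prob_ge (R : realType) (j : nat) :
  Num.sqrt (2 / pi) * Num.sqrt (j.*2.+1)%:R <= (j.*2.+1)%:R * central_prob R j.
Proof.
have := sin_prim_le R j.*2; rewrite sin_prim_even sin_prim_odd.
move: (central_prob R j) (central_prob_gt0 R j) => c c0.
have n0 : 0 < (j.*2.+1)%:R :> R by rewrite ltr0n.
move: (_%:R) n0 => n n0; have p0 := pi_gt0 R.
rewrite -[X in X <= _]mul1r ler_pdivrMr ?mulr_gt0// => h.
rewrite -sqrtrM ?divr_ge0 ?(ltW p0)//.
have nc0 : 0 <= n * c by rewrite mulr_ge0// ltW.
rewrite -(ger0_norm nc0) -sqrtr_sqr ler_wsqrtr//.
rewrite mulrAC ler_pdivrMr//.
have -> : (n * c) ^+ 2 * pi = (n * 2) * (pi / 2 * c * (n * c)) by field.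
by rewrite (mulrC 2) ler_peMr// mulr_ge0// ltW.
Qed.

(* A midpoint rule for the concave function sqrt (2t) on [0, m]. *)
Lemma sum_sqrt_odd_ge (R : realType) (m : nat) :
  (m.*2)%:R * Num.sqrt (m.*2)%:R / 3 <= \sum_(d < m) Num.sqrt (d.*2.+1)%:R :> R.
Proof.
elim: m => [|m IH]; first by rewrite big_ord0 !mul0r.
rewrite big_ord_recr /=; apply: le_trans (lerD IH (lexx _)).
rewrite doubleS.
set a : R := Num.sqrt _.+2%:R; set b : R := Num.sqrt m.*2%:R.
set c : R := Num.sqrt _.+1%:R.
have a0 : 0 <= a by rewrite sqrtr_ge0.
have b0 : 0 <= b by rewrite sqrtr_ge0.
have c0 : 0 < c by rewrite sqrtr_gt0 ltr0n.
have a2 : m.*2.+2%:R = a ^+ 2 by rewrite sqr_sqrtr.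
have b2 : m.*2%:R = b ^+ 2 by rewrite sqr_sqrtr.
have c2 : m.*2.+1%:R = c ^+ 2 by rewrite sqr_sqrtr.
have ab : a ^+ 2 = b ^+ 2 + 2 by rewrite -a2 -b2 -addn2 natrD.
have cb : c ^+ 2 = b ^+ 2 + 1 by rewrite -c2 -b2 -addn1 natrD.
rewrite a2 b2.
(* This is [a ^ 3 - b ^ 3 <= 3 c] multiplied by [a + b], since [a ^ 2 - b ^ 2 = 2]. Squaring and
   using [c ^ 2 = (a ^ 2 + b ^ 2) / 2] leaves a difference divisible by [(a - b) ^ 2]. *)
have h : 2 * (a ^+ 2 + a * b + b ^+ 2) <= 3 * c * (a + b).
  rewrite -ler_sqr ?nnegrE; [|nra|nra].
  have -> : (3 * c * (a + b)) ^+ 2 = 9 * ((a ^+ 2 + b ^+ 2) / 2) * (a + b) ^+ 2.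
    have -> : (a ^+ 2 + b ^+ 2) / 2 = c ^+ 2 by rewrite ab cb; field.
    by ring.
  rewrite -subr_ge0.
  rewrite (_ : _ - _ =
    (a - b) ^+ 2 * (a ^+ 2 + b ^+ 2 + 4 * (a * b)) / 2); last by field.
  rewrite divr_ge0// mulr_ge0 ?sqr_ge0//.
  by rewrite !addr_ge0 ?sqr_ge0 ?mulr_ge0.
have s0 : 0 < a + b by nra.
rewrite -(ler_pM2r s0).
have e : (a ^+ 2 * a - b ^+ 2 * b) * (a + b) = 2 * (a ^+ 2 + a * b + b ^+ 2).
  transitivity ((a ^+ 2 - b ^+ 2) * (a ^+ 2 + a * b + b ^+ 2)); first by ring.
  by rewrite ab; ring.
lra.
Qed.

(** * The simple random walk *)

(** The walk is encoded by its averaging operator on test functions, so expectations need no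
    probability space. *)
Definition walk_step (R : realType) (g : int -> R) (s : int) : R :=
  (g (s + 1) + g (s - 1)) / 2.

(* The expectation of g at time k for the walk started at s. *)
Definition walk (R : realType) (k : nat) : (int -> R) -> int -> R :=
  iter k (@walk_step R).

Lemma walkS (R : realType) k (g : int -> R) :
  walk k.+1 g = walk k (walk_step g).
Proof. by rewrite /walk iterSr. Qed.

Definition flip_at (I : finType) (i0 : I) (y : {ffun I -> bool}) :=
  [ffun i => if i == i0 then ~~ y i else y i].

Lemma flip_atK (I : finType) (i0 : I) : involutive (flip_at i0).
Proof.
by move=> y; apply/ffunP => i; rewrite !ffunE; case: eqP => // _; rewrite negbK.
Qed.

Lemma sgnN (b : bool) : sgn (~~ b) = - sgn b.
Proof. by case: b; rewrite /sgn ?expr0 ?expr1 ?opprK. Qed.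

Lemma sgnM (b c : bool) : sgn b * sgn c = sgn (b (+) c).
Proof. by case: b; case: c. Qed.

(* Pairing each y with its flip at a point of J performs one step of the walk. *)
Lemma sum_signs (R : realType) (I : finType) (J : {set I}) (b : I -> bool)
    (g : int -> R) :
  \sum_(y : {ffun I -> bool}) g (\sum_(i in J) sgn (b i) * sgn (y i))
    = 2 ^+ #|I| * walk #|J| g 0.
Proof.
move eqk : #|J| => k; elim: k J eqk g => [|k IH] J.
  move=> /cards0_eq -> g; under eq_bigr do rewrite big_set0.
  by rewrite sumr_const card_ffun card_bool -natrX mulr_natl.
move=> Jk g.
have [j0 j0J] : exists j, j \in J by apply/card_gt0P; rewrite Jk.
have Jk' : #|J :\ j0| = k by move: Jk; rewrite (cardsD1 j0) j0J => -[].
rewrite walkS -(IH _ Jk').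
set S := LHS.
have SE : S = \sum_(y : {ffun I -> bool})
    g (\sum_(i in J :\ j0) sgn (b i) * sgn (y i) + sgn (b j0) * sgn (y j0)).
  by apply: eq_bigr => y _; rewrite (big_setD1 j0)//= addrC.
have SE' : S = \sum_(y : {ffun I -> bool})
    g (\sum_(i in J :\ j0) sgn (b i) * sgn (y i) - sgn (b j0) * sgn (y j0)).
  rewrite SE (reindex_inj (inv_inj (flip_atK j0))) /=.
  apply: eq_bigr => y _; rewrite ffunE eqxx sgnN mulrN; congr (g (_ - _)).
  by apply: eq_bigr => i; rewrite !inE ffunE => /andP[/negPf ->].
(* Averaging the two expressions of [S] yields [walk_step], whatever the sign [b j0]. *)
have -> : S = (S + S) / 2 by field.
rewrite {1}SE SE' -big_split /= mulr_suml; apply: eq_bigr => y _.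
rewrite /walk_step sgnM; case: (_ (+) _); rewrite /sgn ?expr0 ?expr1 ?opprK //.
by rewrite addrC.
Qed.

Lemma walkD (R : realType) k (f g : int -> R) s :
  walk k (fun t => f t + g t) s = walk k f s + walk k g s.
Proof.
elim: k s => [//|k IH] s; rewrite /walk !iterS -!/(walk _ _) /walk_step !IH.
by field.
Qed.

(** The exponential is an eigenfunction of [walk_step] with eigenvalue [cosh lam]. *)
Lemma walk_exp (R : realType) (lam : R) k s :
  walk k (fun t => expR (lam * t%:~R)) s
    = ((expR lam + expR (- lam)) / 2) ^+ k * expR (lam * s%:~R).
Proof.
elim: k s => [|k IH] s; first by rewrite mul1r.
rewrite /walk iterS -/(walk _ _) /walk_step !IH exprS rmorphD rmorphB /=.
by rewrite mulrDr mulrBr mulr1 !expRD; field.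
Qed.

Definition at0 (R : realType) (s : int) : R := (s == 0)%:R.

Lemma walk_at0_ge0 (R : realType) k s : 0 <= walk k (@at0 R) s.
Proof.
elim: k s => [|k IH] s; first by rewrite /= ler0n.
by rewrite /walk iterS /walk_step divr_ge0// addr_ge0// IH.
Qed.

Lemma walk_at0_out (R : realType) k (s : int) : (k < `|s|)%N ->
  walk k (@at0 R) s = 0.
Proof.
elim: k s => [|k IH] s ks; first by rewrite /= /at0; case: eqP ks => // ->.
by rewrite /walk iterS -/(walk _ _) /walk_step !IH ?addr0 ?mul0r//; lia.
Qed.

(** Starting from [2i - k], the walk is at 0 after [k] steps exactly when [i] of them go down. The
    induction is Pascal's rule; for [i = 0] the lower neighbour is out of reach of 0. *)
Lemma walk_at0 (R : realType) k i :
  walk k (@at0 R) (i.*2%:Z - k%:Z) = 'C(k, i)%:R / 2 ^+ k.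
Proof.
elim: k i => [|k IH] i.
  by rewrite /= /at0 bin0n subr0 expr0 divr1; case: i.
rewrite /walk iterS -/(walk _ _) /walk_step.
case: i => [|i].
  have -> : 0.*2%:Z - k.+1%:Z + 1 = 0.*2%:Z - k%:Z by lia.
  rewrite IH walk_at0_out; last by lia.
  by rewrite !bin0 exprS addr0 invfM mulrCA mulrC.
have -> : i.+1.*2%:Z - k.+1%:Z + 1 = i.+1.*2%:Z - k%:Z by lia.
have -> : i.+1.*2%:Z - k.+1%:Z - 1 = i.*2%:Z - k%:Z by lia.
by rewrite !IH binS natrD exprS invfM; field; rewrite expf_neq0.
Qed.

Lemma walk_at0_center (R : realType) j :
  walk j.*2 (@at0 R) 0 = central_prob R j.
Proof. by rewrite /central_prob -walk_at0 subrr. Qed.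

Definition walk_abs (R : realType) k : R := walk k (fun s => `|s|%:~R) 0.

(** The mean of [|s + 1|] and [|s - 1|] is [|s|], except at [s = 0], where it is larger by 1. *)
Lemma walk_absS (R : realType) k :
  walk_abs R k.+1 = walk_abs R k + walk k (@at0 R) 0.
Proof.
rewrite /walk_abs walkS -walkD; congr (walk k _ 0).
apply/funext => s; rewrite /walk_step /at0 -rmorphD /=.
have -> : `|s + 1| + `|s - 1| = `|s| * 2 + (s == 0)%:R * 2 by lia.
by rewrite rmorphD !rmorphM /= !rmorph_nat; field.
Qed.

Lemma walk_abs_ge0 (R : realType) k : 0 <= walk_abs R k.
Proof.
elim: k => [|k IH]; first by rewrite /walk_abs /= normr0.
by rewrite walk_absS addr_ge0// walk_at0_ge0.
Qed.

Lemma walk_absS_le (R : realType) k : walk_abs R k <= walk_abs R k.+1.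
Proof. by rewrite walk_absS lerDl walk_at0_ge0. Qed.

(** With [c_j = central_prob R j], [central_probS] gives [(2j+3) c_(j+1) = (2j+1) c_j + c_(j+1)],
    and [c_(j+1)] is the increment of [walk_abs] from time [2j+2] to [2j+3]. *)
Lemma walk_abs_odd_ge (R : realType) j :
  (j.*2.+1)%:R * central_prob R j <= walk_abs R j.*2.+1.
Proof.
elim: j => [|j IH]; rewrite walk_absS walk_at0_center.
  by rewrite mul1r lerDr walk_abs_ge0.
rewrite -natr1 mulrDl mul1r lerD2r doubleS central_probS.
exact: le_trans IH (walk_absS_le _ _).
Qed.

(** * The rows of the diamond *)

Definition board_row (n : nat) (H : {set grid n}) (i : 'I_n) : {set 'I_n} :=
  [set j | (i, j) \in H]%SET.

Definition border_dist (n i : nat) : nat := minn i (n.-1 - i).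

Lemma mem_diamond (n : nat) (i j : 'I_n) :
  ((i, j) \in diamond n) =
  (n./2 - border_dist n i <= j < (n.-1)./2 + border_dist n i + 1)%N.
Proof.
(* Doubling clears the denominators and leaves an inequality between integers. *)
have -> : ((i, j) \in diamond n) =
    (`|(i.*2)%:Z - (n.-1)%:Z| + `|(j.*2)%:Z - (n.-1)%:Z| <= (n.-1)%:Z).
  rewrite inE /= -(ler_int rat) rmorphD /= !intr_norm !rmorphB /=.
  rewrite -!pmulrn.
  have n0 : (0 < n)%N by case: n i {j} => [[]|].
  have -> : n.+1%:R = (n.-1%:R + 2%:R) :> rat by rewrite -natrD; congr (_%:R); lia.
  have -> : n%:R = (n.-1%:R + 1%:R) :> rat by rewrite -natrD; congr (_%:R); lia.
  rewrite -!mul2n !natrM -!natr1.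
  have E (x y : rat) : x + 1 - (y + 2) / 2 = (2 * x - y) / 2 by field.
  rewrite !E !normrM !(@ger0_norm _ 2^-1)// -mulrDl addrK.
  by rewrite ler_pM2r.
have := ltn_ord i; have := ltn_ord j.
rewrite /border_dist; move: (nat_of_ord i) (nat_of_ord j) => {}i {}j.
lia.
Qed.

Lemma card_ord_itv (n a b : nat) :
  #|[set j : 'I_n | (a <= j < b)%N]%SET| = (minn b n - a)%N.
Proof.
rewrite -sum1_card big_mkcond /=.
under eq_bigr do rewrite inE.
elim: n => [|n IH]; first by rewrite big_ord0 minn0.
by rewrite big_ord_recr /= IH; case: ifP; lia.
Qed.

Lemma card_row_diamond (n : nat) (i : 'I_n) :
  #|board_row (diamond n) i| = ((border_dist n i).*2 + odd n)%N.
Proof.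
rewrite (_ : board_row _ _ = [set j : 'I_n |
    (n./2 - border_dist n i <= j < n.-1./2 + border_dist n i + 1)%N]%SET).
  rewrite card_ord_itv; have := ltn_ord i; rewrite /border_dist; lia.
by apply/setP => j; rewrite !inE -mem_diamond inE.
Qed.

(** Rows pair up under reflection, an odd [n] leaving the middle one. The induction peels off the
    two outer rows, which lowers every remaining distance by one. *)
Lemma sum_border_dist (V : nmodType) (n : nat) (F : nat -> V) :
  \sum_(i < n) F (border_dist n i)
    = (\sum_(d < n./2) F d) *+ 2 + F n./2 *+ odd n.
Proof.
elim/ltn_ind: n F => -[|[|n]] IH F.
- by rewrite !big_ord0 mul0rn addr0.
- by rewrite big_ord1 big_ord0 mul0rn add0r.
rewrite big_ord_recl big_ord_recr /= [in RHS]big_ord_recl.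
have -> : F (border_dist n.+2 (bump 0 n)) = F 0.
  by congr F; rewrite /border_dist /bump; lia.
rewrite (_ : border_dist n.+2 0 = 0)//.
rewrite (eq_bigr (fun i : 'I_n => (F \o S) (border_dist n i))); last first.
  move=> i _ /=; congr F; rewrite /border_dist /bump /=; have := ltn_ord i; lia.
rewrite IH//= mulrnDl negbK -!addrA; congr (_ + _).
by rewrite [RHS]addrC -!addrA.
Qed.

Lemma card_sum_rows (n : nat) (H : {set grid n}) :
  #|H| = \sum_(i < n) #|board_row H i|.
Proof.
rewrite -sum1_card (eq_bigr (fun i => \sum_(j in board_row H i) 1)%N); last first.
  by move=> i _; rewrite sum1_card.
rewrite pair_big_dep /=; apply: eq_bigl => -[i j]; by rewrite !inE.
Qed.

(** The board has [2m(m-1)] cells if [n = 2m], and [2m^2 + 2m + 1] if [n = 2m+1], where equality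
    holds. *)
Lemma card_diamond_le (n : nat) : (#|diamond n|.*2 <= n * n + 1)%N.
Proof.
rewrite card_sum_rows (eq_bigr _ (fun i _ => card_row_diamond i)).
rewrite (sum_border_dist n (fun d => d.*2 + odd n)%N).
have E m o : (\sum_(d < m) (d.*2 + o) = m * m.-1 + m * o)%N.
  elim: m => [|m IH]; first by rewrite big_ord0.
  rewrite big_ord_recr /= IH; case: m {IH} => [|m] /=; nia.
rewrite E; move: (odd_double_half n); case: (odd n) => /=; move: (n./2) => m <-.
  by case: m => [|m] /=; nia.
by case: m => [|m] /=; nia.
Qed.

(** * Bounds for an arbitrary board *)

Definition row_disc (n : nat) (H : {set grid n}) (a : config n)
    (y : {ffun 'I_n -> bool}) (i : 'I_n) : int :=
  \sum_(j in board_row H i) sgn (a (i, j)) * sgn (y j).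

Lemma signed_disc_rows (n : nat) (H : {set grid n}) (a : config n)
    (x y : {ffun 'I_n -> bool}) :
  signed_disc H a (x, y) = \sum_i sgn (x i) * row_disc H a y i.
Proof.
under [RHS]eq_bigr do rewrite mulr_sumr.
rewrite pair_big_dep /=; apply: eq_big => [[i j]|[i j] _]; rewrite ?inE//=.
by rewrite mulrCA mulrA.
Qed.

Lemma best_disc_ge_rows (n : nat) (H : {set grid n}) (a : config n)
    (y : {ffun 'I_n -> bool}) :
  \sum_i `|row_disc H a y i| <= best_disc H a.
Proof.
(* The value [true] stands for the sign -1, so exactly the rows with negative sum are reversed. *)
pose x := [ffun i => row_disc H a y i < 0].
rewrite (_ : \sum_i _ = signed_disc H a (x, y)); first exact: le_bigmax.
rewrite signed_disc_rows; apply: eq_bigr => i _; rewrite ffunE /sgn.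
case: ltrP => h; first by rewrite expr1 mulN1r ltr0_norm.
by rewrite expr0 mul1r ger0_norm.
Qed.

(** Average [best_disc_ge_rows] over all [y]; by [sum_signs] the mean of each row depends only on
    its length, not on [a]. *)
Lemma best_disc_ge (R : realType) (n : nat) (H : {set grid n}) (a : config n) :
  \sum_i walk_abs R #|board_row H i| <= (best_disc H a)%:~R.
Proof.
have p0 : 0 < 2 ^+ n :> R by rewrite exprn_gt0.
rewrite -(ler_pM2l p0).
have -> : 2 ^+ n * (best_disc H a)%:~R
    = \sum_(y : {ffun 'I_n -> bool}) (best_disc H a)%:~R :> R.
  by rewrite sumr_const card_ffun card_bool card_ord -natrX mulr_natl.
have -> : 2 ^+ n * \sum_i walk_abs R #|board_row H i| =
    \sum_(y : {ffun 'I_n -> bool}) \sum_i (`|row_disc H a y i|)%:~R.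
  rewrite exchange_big mulr_sumr /=; apply: eq_bigr => i _.
  have := sum_signs (board_row H i) (fun j => a (i, j)) (fun s => `|s|%:~R : R).
  by rewrite card_ord => <-.
apply: ler_sum => y _; rewrite -rmorph_sum /= ler_int.
exact: best_disc_ge_rows.
Qed.

Lemma max_disc_ge (R : realType) (n : nat) (H : {set grid n}) :
  \sum_i walk_abs R #|board_row H i| <= (max_disc H)%:~R.
Proof.
apply: (big_ind (fun v : int => _ <= v%:~R)) => [|u v Hu Hv|a _].
- exact: best_disc_ge.
- by rewrite minEle; case: ifP.
- exact: best_disc_ge.
Qed.

(** * Upper bound by exponential moments *)

Lemma max_disc_le_best (n : nat) (H : {set grid n}) (a : config n) :
  max_disc H <= best_disc H a.
Proof. by rewrite /max_disc; apply: bigmin_le. Qed.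

Lemma best_disc_attained (n : nat) (H : {set grid n}) (a : config n) :
  exists s, best_disc H a = signed_disc H a s.
Proof.
rewrite /best_disc; elim/big_ind: _ => [|u v [s ->] [t ->]|s _]; last by exists s.
  by exists ([ffun=> false], [ffun=> false]).
by rewrite maxEle; case: ifP => _; [exists t|exists s].
Qed.

Definition opp_setting (n : nat) (s : setting n) : setting n :=
  ([ffun i => ~~ s.1 i], [ffun i => ~~ s.2 i]).

Lemma signed_disc_opp (n : nat) (H : {set grid n}) (a : config n)
    (s : setting n) :
  signed_disc H a (opp_setting s) = signed_disc H a s.
Proof.
by apply: eq_bigr => p _; rewrite !ffunE !sgnN; ring.
Qed.

(** An optimal setting and its opposite are distinct and contribute equal terms; the other terms are
    nonnegative. *)
Lemma expR_best_disc_le (R : realType) (n : nat) (H : {set grid n})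
    (a : config n) (lam : R) : (0 < n)%N ->
  expR (lam * (best_disc H a)%:~R) *+ 2
    <= \sum_(s : setting n) expR (lam * (signed_disc H a s)%:~R).
Proof.
move=> n0; have [s ->] := best_disc_attained H a.
have sN : opp_setting s != s.
  apply/eqP => /(congr1 (fun t : setting n => t.1 (Ordinal n0))).
  by rewrite ffunE; case: (s.1 _).
rewrite (bigD1 s)//= (bigD1 (opp_setting s))//= signed_disc_opp addrA -mulr2n.
by rewrite lerDl sumr_ge0// => t _; rewrite expR_ge0.
Qed.

Lemma expR_max_disc_le (R : realType) (n : nat) (H : {set grid n}) (lam : R) :
  (0 < n)%N -> 0 <= lam ->
  expR (lam * (max_disc H)%:~R)
    <= 2 ^+ (n.*2.-1) * ((expR lam + expR (- lam)) / 2) ^+ #|H|.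
Proof.
move=> n0 lam0; set c := _ / 2.
have p0 : 0 < 2 ^+ (n * n) :> R by rewrite exprn_gt0.
rewrite -(ler_pM2l p0) -(ler_pM2l (ltr0Sn R 1)).
have -> : 2 * (2 ^+ (n * n) * expR (lam * (max_disc H)%:~R)) =
   \sum_(a : config n) expR (lam * (max_disc H)%:~R) *+ 2.
  rewrite sumr_const card_ffun card_bool card_prod card_ord.
  by rewrite -natrX -[in RHS](mulr_natl _ (2 ^ _)) mulrnAr [LHS]mulr_natl.
have -> : 2 * (2 ^+ (n * n) * (2 ^+ n.*2.-1 * c ^+ #|H|)) =
    \sum_(s : setting n) \sum_(a : config n)
      expR (lam * (signed_disc H a s)%:~R).
  rewrite (eq_bigr (fun=> 2 ^+ (n * n) * c ^+ #|H|)).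
    rewrite sumr_const card_prod !card_ffun card_bool card_ord.
    rewrite -expnD addnn -[RHS]mulr_natl natrX.
    rewrite -{2}(prednK (n := n.*2)) ?double_gt0//.
    by rewrite exprS; ring.
  move=> s _.
  (* Here the configuration plays the random signs, and the fixed setting supplies the
     coefficients. *)
  have := sum_signs H (fun p => s.1 p.1 (+) s.2 p.2)
    (fun t => expR (lam * t%:~R)).
  rewrite card_prod card_ord walk_exp mulr0 expR0 mulr1 => <-.
  apply: eq_bigr => a _; congr (expR (_ * _%:~R)); apply: eq_bigr => p _.
  by rewrite -sgnM; ring.
rewrite exchange_big /=; apply: ler_sum => a _.
apply: le_trans (expR_best_disc_le H a lam n0).
by rewrite lerMn2r /= ler_expR ler_wpM2l// ler_int max_disc_le_best.
Qed.

Lemma max_disc_le (R : realType) (n : nat) (H : {set grid n}) (h : R) :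
  (0 < n)%N -> 0 < h -> #|H|%:R <= h ->
  (max_disc H)%:~R <= Num.sqrt (2 * h * ((n.*2.-1)%:R * ln 2)).
Proof.
move=> n0 h0 Hh.
set l := _%:R * ln 2; set F := _%:~R.
have l0 : 0 < l by rewrite mulr_gt0 ?ltr0n ?ln_gt0 ?ltr1n//; lia.
have el : expR l = 2 ^+ n.*2.-1 by rewrite /l expRM_natl lnK// posrE.
move: l l0 el => l l0 el.
(* This minimizes [l / lam + lam * h / 2], whose minimum is [lam * h = sqrt (2 h l)]. *)
pose lam := Num.sqrt (2 * l / h).
have lam0 : 0 < lam by rewrite sqrtr_gt0 divr_gt0// mulr_gt0.
have lam2 : lam ^+ 2 = 2 * l / h.
  by rewrite sqr_sqrtr// divr_ge0 ?mulr_ge0// ltW.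
have : lam * F <= l + lam ^+ 2 / 2 * h.
  rewrite -ler_expR; apply: le_trans (expR_max_disc_le H n0 (ltW lam0)) _.
  rewrite expRD ler_pM ?exprn_ge0 ?divr_ge0 ?addr_ge0 ?expR_ge0//.
    by rewrite el.
  apply: le_trans (_ : expR (lam ^+ 2 / 2) ^+ #|H| <= _).
    rewrite lerXn2r ?nnegrE ?divr_ge0 ?addr_ge0 ?expR_ge0//.
    exact: expR_sqr_ge_cosh.
  by rewrite -expRM_natr ler_expR ler_wpM2l// divr_ge0// sqr_ge0.
rewrite -ler_pdivlMl// => /le_trans; apply.
rewrite ler_pdivrMl// lam2.
rewrite (_ : Num.sqrt _ = lam * h).
  rewrite mulrA -expr2 lam2 divfK ?gt_eqF//.
  rewrite (_ : 2 * l / h / 2 * h = l); first lra.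
  by field; rewrite gt_eqF.
rewrite -(ger0_norm (ltW h0)) -[in RHS]sqrtr_sqr.
rewrite -sqrtrM ?divr_ge0 ?mulr_ge0 ?(ltW h0) ?(ltW l0)//.
by rewrite (ger0_norm (ltW h0)); congr Num.sqrt; field; rewrite gt_eqF.
Qed.

(** * The diamond *)

Lemma powR_three_halves (R : realType) (n : nat) :
  n%:R `^ (3 / 2) = n%:R * Num.sqrt n%:R :> R.
Proof.
case: n => [|n]; first by rewrite mul0r powR0// gt_eqF// divr_gt0.
rewrite -powR12_sqrt ?ler0n// -[X in _ = X * _]powRr1 ?ler0n//.
rewrite -powRD; last by rewrite pnatr_eq0 implybT.
by congr (_ `^ _); field.
Qed.

Lemma max_disc_diamond_ge (R : realType) (n : nat) :
  Num.sqrt (2 / pi) * ((2 / 3) * ((n.-1)./2.*2%:R * Num.sqrt (n.-1)./2.*2%:R))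
    <= (max_disc (diamond n))%:~R :> R.
Proof.
apply: le_trans (max_disc_ge R (diamond n)).
rewrite (eq_bigr _ (fun i _ => congr1 (walk_abs R) (card_row_diamond i))).
rewrite (sum_border_dist n (fun d => walk_abs R (d.*2 + odd n)%N)).
set m := n.-1./2.
apply: (@le_trans _ _ ((\sum_(d < m) walk_abs R d.*2.+1) *+ 2)).
  rewrite -[leRHS]mulr_natl.
  have E (u v : R) : u * (2 / 3 * v) = 2 * (u * (v / 3)) by field.
  rewrite E.
  rewrite ler_pM2l//.
  apply: (@le_trans _ _ (Num.sqrt (2 / pi) * \sum_(d < m) Num.sqrt d.*2.+1%:R)).
    by rewrite ler_wpM2l ?sqrtr_ge0// sum_sqrt_odd_ge.
  rewrite mulr_sumr; apply: ler_sum => d _.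
  exact: le_trans (central_prob_ge R d) (walk_abs_odd_ge R d).
apply: (@le_trans _ _ ((\sum_(d < n./2) walk_abs R (d.*2 + odd n)) *+ 2));
  last first.
  by rewrite lerDl; case: (odd n); rewrite ?mulr0n ?mulr1n// walk_abs_ge0.
(* For odd [n] the lengths are exactly [2d+1] with [d < m]. For positive even [n] they are
   [0, 2, ..., 2m]: the length 0 is dropped and [2d+2] is compared with [2d+1]. *)
rewrite lerMn2r /=; case: (boolP (odd n)) => on.
  rewrite (_ : n./2 = m); last by rewrite /m; lia.
  by apply: ler_sum => d _; rewrite addn1.
case: n @m on => [|n] m on; first by rewrite !big_ord0.
rewrite (_ : n.+1./2 = m.+1); last by rewrite /m /=; move: on => /=; lia.
rewrite [leRHS]big_ord_recl /=; apply: ler_wpDl; first exact: walk_abs_ge0.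
by apply: ler_sum => d _; rewrite addn0 /bump doubleS; exact: walk_absS_le.
Qed.

Lemma max_disc_diamond_asymp (R : realType) (n : nat) :
  (1 - 4 / n%:R) * (2 / 3 * Num.sqrt (2 / pi)) * n%:R `^ (3 / 2)
    <= (max_disc (diamond n))%:~R :> R.
Proof.
apply: le_trans (max_disc_diamond_ge R n); rewrite powR_three_halves.
rewrite [leRHS]mulrA [X in _ <= X * _]mulrC (mulrC (1 - _)) -[leLHS]mulrA.
rewrite ler_wpM2l ?mulr_ge0 ?sqrtr_ge0//.
case: (ltnP n 2) => n2.
  apply: le_trans (_ : 0 <= _); last by rewrite mulr_ge0 ?sqrtr_ge0.
  case: n n2 => [|[|//]] _; first by rewrite mul0r mulr0.
  by rewrite sqrtr1; lra.
set m := _.*2; have : (n - 2 <= m)%N by rewrite /m; lia.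
rewrite -(ler_nat R) natrB//; set y := m%:R; set x := n%:R => xy.
have x0 : 2 <= x by rewrite ler_nat.
have xV : x / x = 1 by rewrite divff// gt_eqF//; lra.
have xV0 : 0 < x^-1 by rewrite invr_gt0; lra.
(* From [y >= x - 2 = r x] and [0 <= r <= 1] follows [y sqrt y >= r ^ 2 x sqrt x], and
   [r ^ 2 >= 1 - 4 / x]. *)
pose r := 1 - 2 / x.
have rx : x * r = x - 2 by rewrite /r; nra.
have r0 : 0 <= r by rewrite /r; nra.
have r1 : r <= 1 by rewrite /r; nra.
have s : r * Num.sqrt x <= Num.sqrt y.
  rewrite -{1}(ger0_norm r0) -sqrtr_sqr -sqrtrM ?sqr_ge0// ler_wsqrtr//; nra.
apply: le_trans (_ : (x * r) * (r * Num.sqrt x) <= _); last first.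
  apply: ler_pM => //; first by nra.
    by rewrite mulr_ge0 ?sqrtr_ge0.
  by rewrite rx.
rewrite (_ : x * r * _ = r ^+ 2 * (x * Num.sqrt x)); last by ring.
apply: ler_wpM2r; first by rewrite mulr_ge0 ?sqrtr_ge0//; lra.
by rewrite /r; nra.
Qed.

Lemma max_disc_diamond_le (R : realType) (n : nat) :
  (max_disc (diamond n))%:~R <= Num.sqrt (2 * ln 2) * n%:R `^ (3 / 2) :> R.
Proof.
rewrite powR_three_halves; case: n => [|n].
  rewrite mul0r mulr0 lerz0.
  apply: le_trans (max_disc_le_best _ [ffun=> false]) _.
  have [s ->] := best_disc_attained (diamond 0) [ffun=> false].
  by rewrite /signed_disc big1// => -[[]].
set x : R := n.+1%:R; have x1 : 1 <= x by rewrite ler1n.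
have ln2 : 0 <= ln 2 :> R by rewrite ln_ge0// ler1n.
(* The bound [h = (x ^ 2 + 1) / 2] on the number of cells comes from [card_diamond_le]. *)
apply: (@le_trans _ _
  (Num.sqrt (2 * ((x ^+ 2 + 1) / 2) * ((n.+1.*2.-1)%:R * ln 2)))).
  apply: max_disc_le => //; first by nra.
  rewrite ler_pdivlMr// -natrM muln2 /x -natrX natr1 ler_nat.
  rewrite -mulnn -[leqRHS]addn1.
  exact: card_diamond_le.
have x0 : 0 <= x by lra.
rewrite -[X in _ <= _ * (X * _)](ger0_norm x0) -sqrtr_sqr.
rewrite -sqrtrM ?sqr_ge0// -sqrtrM ?mulr_ge0// ler_wsqrtr//.
have -> : n.+1.*2.-1%:R = 2 * x - 1 :> R.
  by rewrite /x -natrM mul2n; apply/eqP; rewrite eq_sym subr_eq natr1.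
rewrite -subr_ge0 (_ : _ - _ = ln 2 * (x - 1) ^+ 2); last by field.
by rewrite mulr_ge0// sqr_ge0.
Qed.

Theorem theorem7 (R : realType) :
  [/\ (fun n : nat => (max_disc (diamond n))%:~R : R)
        =Theta_\oo (fun n : nat => n%:R `^ (3 / 2) : R),
      exists2 eps : nat -> R, eps n @[n --> \oo] --> (0 : R) &
        forall n : nat,
          (1 + eps n) * (2 / 3 * Num.sqrt (2 / pi)) * n%:R `^ (3 / 2)
            <= (max_disc (diamond n))%:~R
    & forall n : nat,
        (max_disc (diamond n))%:~R <= Num.sqrt (2 * ln 2) * n%:R `^ (3 / 2) :> R].
Proof.
have c0 : 0 < 2 / 3 * Num.sqrt (2 / pi) :> R.
  by rewrite mulr_gt0 ?divr_gt0 ?sqrtr_gt0 ?divr_gt0 ?pi_gt0.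
split; last exact: max_disc_diamond_le.
- rewrite eqThetaE qualifE; apply/asboolP.
  exists (2 / 3 * Num.sqrt (2 / pi) / 2, Num.sqrt (2 * ln 2)) => /=.
    by rewrite divr_gt0//= sqrtr_gt0 mulr_gt0// ln_gt0// ltr1n.
  (* From 8 on, [1 - 4 / n >= 1 / 2], which accounts for the halved lower constant. *)
  exists 8%N => // n /= n8.
  have p0 : 0 <= n%:R `^ (3 / 2) :> R by rewrite powR_ge0.
  have F0 : 2 / 3 * Num.sqrt (2 / pi) / 2 * n%:R `^ (3 / 2)
      <= (max_disc (diamond n))%:~R :> R.
    apply: le_trans (max_disc_diamond_asymp R n).
    rewrite ler_wpM2r// mulrC ler_wpM2r ?(ltW c0)//.
    have n0 : 0 < n%:R :> R by rewrite ltr0n (leq_trans _ n8).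
    rewrite lerBrDr -lerBrDl ler_pdivrMr//.
    have : 8 <= n%:R :> R by rewrite (ler_nat R 8).
    lra.
  rewrite (ger0_norm p0) ger0_norm.
    by split => //; exact: max_disc_diamond_le.
  by apply: le_trans F0; rewrite mulr_ge0 ?divr_ge0 ?(ltW c0).
- exists (fun n => - (4 / n%:R)); last exact: max_disc_diamond_asymp.
  (* After the shift the sequence is [-4] times the harmonic sequence [1 / (n + 1)]. *)
  rewrite -cvg_shiftS /=.
  have := @cvg_harmonic R => /(@cvgMl_tmp _ _ _ _ _ (-4)).
  rewrite mulr0; apply: cvg_trans; apply: near_eq_cvg; near=> n.
  by rewrite /= mulNr.
Unshelve. all: by end_near.
Qed.
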